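(* The surfaces of revolution $\Sigma=\{(t,r):t=f(r)\}$ in the Heisenberg group $\mathbb{H}$ that have constant symplectic distortion $Q^h_\Sigma=q$ are given by: (1) the two parameter family of surfaces $$(t-C')^2=\frac{1}{9C^2}(Cr^2-4)^3,\qquad Cr^2-4>0,$$ with parameters $C,C'\in\mathbb{R}$, if $q=0$; (2) the two parameter family of surfaces defined by $$f(r)=\int_{r_0}^r 2s\,\tan\left(\pm\arccos\left(-\frac{qs}{2}-\frac{c_1}{s}\right)\right)ds,$$ where $r_0>0$ is a constant and $c_1$ is a constant, if $q\neq0$.
   Context: The Heisenberg group $\mathbb{H}$ is $\mathbb{R}^3$ with coordinates $(x,y,t)$ and group law $(x,y,t)\cdot(x',y',t')=(x+x',y+y',t+t'+2(yx'-xy'))$. Its left-invariant frame is $X=\partial_x+2y\,\partial_t$, $Y=\partial_y-2x\,\partial_t$, $T=\partial_t$. For a surface $\Sigma=\{u=0\}$ with $C^2$ defining function $u$, put $\|\nabla_Hu\|=\sqrt{(Xu)^2+(Yu)^2}$. At non-characteristic points (those where $\|\nabla_Hu\|\neq0$) the symplectic distortion is $$Q^h_\Sigma=X\left(\frac{Yu}{\|\nabla_Hu\|}\right)-Y\left(\frac{Xu}{\|\nabla_Hu\|}\right).$$ A surface of revolution is a surface defined by $u(x,y,t)=t-f(r)=0$ with $r=\sqrt{x^2+y^2}$.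
   Formalization: In (2) the arccos argument is required to lie in (0,1] (where it is negative the formula gives distortion −q), and an additive constant f(r_0) is included since vertical translates also have distortion q; f is C^2 on an open interval of positive radii. *)

(* Defs.v *)
From Stdlib Require Import Reals.
From Coquelicot Require Import Coquelicot.
Open Scope R_scope.

(** Heisenberg group in coordinates [(x, y, t)], group law
    [(x,y,t).(x',y',t') = (x+x', y+y', t+t'+2(y x' - x y'))].
    [heisX] and [heisY] are the left-invariant horizontal fields, acting on
    functions; [Derive] is only meaningful where the function is derivable. *)
Definition heisX (u : R -> R -> R -> R) (x y t : R) : R :=
  Derive (fun s => u s y t) x + 2 * y * Derive (fun s => u x y s) t.

Definition heisY (u : R -> R -> R -> R) (x y t : R) : R :=
  Derive (fun s => u x s t) y - 2 * x * Derive (fun s => u x y s) t.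

Definition hgrad_norm (u : R -> R -> R -> R) (x y t : R) : R :=
  sqrt (heisX u x y t ^ 2 + heisY u x y t ^ 2).

Definition symplectic_distortion (u : R -> R -> R -> R) (x y t : R) : R :=
  heisX (fun x' y' t' => heisY u x' y' t' / hgrad_norm u x' y' t') x y t
  - heisY (fun x' y' t' => heisX u x' y' t' / hgrad_norm u x' y' t') x y t.

Definition constant_distortion
    (Sigma : R -> R -> R -> Prop) (u : R -> R -> R -> R) (q : R) : Prop :=
  forall x y t : R, Sigma x y t -> hgrad_norm u x y t <> 0 ->
    symplectic_distortion u x y t = q.

Definition radius (x y : R) : R := sqrt (x ^ 2 + y ^ 2).

Definition revolution_u (f : R -> R) (x y t : R) : R := t - f (radius x y).

(** [f] is a total function, but only its values on the set of radii [D]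
    are part of the data. *)
Definition revolution_surface (D : R -> Prop) (f : R -> R) (x y t : R) : Prop :=
  D (radius x y) /\ revolution_u f x y t = 0.

(** The upper end may be [p_infty]. *)
Definition radii_between (a : R) (b : Rbar) (r : R) : Prop :=
  a < r /\ Rbar_lt r b.

(** Meant for open [D]. *)
Definition C2_on (D : R -> Prop) (f : R -> R) : Prop :=
  forall r : R, D r ->
    (forall k : nat, (k <= 2)%nat -> ex_derive_n f k r) /\
    continuous (Derive_n f 2) r.

Definition family_zero (D : R -> Prop) (f : R -> R) (C C' : R) : Prop :=
  forall r : R, D r ->
    0 < C * r ^ 2 - 4 /\
    (f r - C') ^ 2 = 1 / (9 * C ^ 2) * (C * r ^ 2 - 4) ^ 3.

Definition arccos_arg (q c1 s : R) : R := - (q * s) / 2 - c1 / s.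

(** [eps] is the sign in [+/- arccos].  The argument of [acos] has to lie in
    [(0, 1]]: beyond [1] the arccosine is undefined ([acos] is a clamped total
    function), at [0] the tangent is infinite, and where the argument is
    negative the same formula produces a surface of distortion [- q].
    The value [f r0] fixes the vertical translation of the surface, which does
    not affect the distortion; it is [0] for [f r = RInt _ r0 r]. *)
Definition family_nonzero
    (D : R -> Prop) (f : R -> R) (q r0 c1 eps : R) : Prop :=
  (eps = 1 \/ eps = - 1) /\
  (forall s : R, D s -> 0 < arccos_arg q c1 s <= 1) /\
  (forall r : R, D r ->
     f r = f r0
           + RInt (fun s => 2 * s * tan (eps * acos (arccos_arg q c1 s))) r0 r).

(* Main.v *)
Require Import Defs.
From Stdlib Require Import Reals Lra Lia Ranalysis5.
From Coquelicot Require Import Coquelicot.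
Open Scope R_scope.

(** Write [N = sqrt (f'^2 + 4 r^2)]. On the surface [t = f r] the horizontal
    gradient has norm [N], which is positive for every [r > 0], so that no point
    over a positive radius is characteristic. Computing with [phi = f' / (r N)]
    and [psi = 2 / N] one has [Xu / N = psi y - phi x] and
    [Yu / N = - psi x - phi y]; in [X (Yu / N) - Y (Xu / N)] the terms with
    [phi'] cancel and the distortion is [- (r^2 psi)' / r], that is
    [- (r tilt)' / r] with [tilt = 2 r / N]
    ([symplectic_distortion_revolution]). Hence the distortion is the constant
    [q] exactly when [r tilt + q r^2 / 2] is a constant [- c1], which says
    [tilt = - q r / 2 - c1 / r] ([constant_distortion_iff_tilt]).

    The number [tilt] lies in [(0, 1]] and is the cosine of the angle whose
    tangent is [f' / (2 r)], so the first integral determines [f'] up to sign: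
    [f' = 2 r tan (+/- acos (- q r / 2 - c1 / r))]. That the sign is the same
    along the whole profile is the delicate point. It could only change where
    [f' = 0], that is where [tilt = 1]. But a function [- q r / 2 - c1 / r]
    which stays at most [1] on an open set of positive radii never takes the
    value [1] there ([arccos_arg_lt_1]); so [f'] has no zero and the
    intermediate value theorem fixes its sign ([tilt_iff_slope]).

    For [q <> 0] the family is the integrated form of this slope equation. For
    [q = 0] the equation reads [f' = +/- r sqrt (C r^2 - 4)] with
    [C = 4 / c1^2], and [(C r^2 - 4)^(3/2) / (3 C)] is an explicit primitive;
    [C'] is the constant of integration ([family_zero_iff]). *)

(** * Functions on intervals *)

Definition order_convex (D : R -> Prop) : Prop :=
  forall x y z : R, D x -> D z -> x <= y <= z -> D y.

Lemma order_convex_between (D : R -> Prop) (x y z : R) :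
  order_convex D -> D x -> D z -> Rmin x z <= y <= Rmax x z -> D y.
Proof.
  intros hD hx hz hy; unfold Rmin, Rmax in hy.
  destruct (Rle_dec x z); [apply (hD x y z) | apply (hD z y x)]; auto; lra.
Qed.

(** [is_derive_unique] is stated over the canonical structures of [R]; with the
    types written over [R] itself it can be used for rewriting. *)
Lemma Derive_of_is_derive (g : R -> R) (x l : R) :
  is_derive g x l -> Derive g x = l.
Proof. apply is_derive_unique. Qed.

Lemma Derive_of_is_derive_loc (g h : R -> R) (x l : R) :
  locally x (fun s => g s = h s) -> is_derive h x l -> Derive g x = l.
Proof.
  intros heq hh; rewrite (Derive_ext_loc _ h) by exact heq.
  apply Derive_of_is_derive, hh.
Qed.

Lemma eq_of_derive_zero (D : R -> Prop) (g : R -> R) (x y : R) :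
  order_convex D -> (forall r, D r -> is_derive g r 0) ->
  D x -> D y -> g x = g y.
Proof.
  intros hD hg hx hy.
  destruct (Rtotal_order x y) as [h | [-> | h]]; [| reflexivity | symmetry];
    apply (eq_is_derive g); auto; intros t ht; apply hg.
  - apply (hD x t y); auto.
  - apply (hD y t x); auto.
Qed.

(** Two functions with equal squares differ by a sign at each point; as [h] has
    no zero, the intermediate value theorem makes this sign constant. *)
Lemma signed_square_root (D : R -> Prop) (g h : R -> R) (r0 : R) :
  order_convex D -> D r0 ->
  (forall r, D r -> continuous g r) ->
  (forall r, D r -> 0 < h r /\ g r ^ 2 = h r ^ 2) ->
  exists eps : R, (eps = 1 \/ eps = - 1) /\ forall r, D r -> g r = eps * h r.
Proof.
  intros hD h0 hc hgh.
  assert (branch : forall r, D r -> g r = h r \/ g r = - h r).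
  { intros r hr; destruct (hgh r hr) as [hpos hsq].
    assert (hprod : (g r - h r) * (g r + h r) = 0) by (ring_simplify; lra).
    apply Rmult_integral in hprod; lra. }
  assert (no_crossing : forall x y, D x -> D y -> g x < 0 -> 0 < g y -> False).
  { intros x y hx hy hgx hgy.
    assert (root : exists z, D z /\ g z = 0).
    { destruct (Rtotal_order x y) as [hlt | [-> | hlt]].
      - destruct (IVT_interv g x y) as [z [hz hz0]]; auto.
        + intros t ht; apply continuity_pt_filterlim, hc, (hD x t y); auto.
        + exists z; split; auto; apply (hD x z y); auto.
      - lra.
      - destruct (IVT_interv (fun t => - g t) y x) as [z [hz hz0]]; try lra.
        + intros t ht; apply continuity_pt_opp, continuity_pt_filterlim, hc.
          apply (hD y t x); auto.
        + exists z; split; [apply (hD y z x); auto | lra]. }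
    destruct root as [z [hz hz0]].
    destruct (hgh z hz); destruct (branch z hz); lra. }
  destruct (hgh r0 h0) as [hpos0 _].
  destruct (branch r0 h0) as [b0 | b0].
  - exists 1; split; auto; intros r hr.
    destruct (hgh r hr) as [hpos _]; destruct (branch r hr); [lra|].
    exfalso; apply (no_crossing r r0); auto; lra.
  - exists (- 1); split; auto; intros r hr.
    destruct (hgh r hr) as [hpos _]; destruct (branch r hr); [|lra].
    exfalso; apply (no_crossing r0 r); auto; lra.
Qed.

(** The fundamental theorem of calculus in both directions; [f r0] is the
    constant of integration. *)
Lemma RInt_iff_is_derive (D : R -> Prop) (f phi : R -> R) (r0 : R) :
  open D -> order_convex D -> D r0 ->
  (forall r, D r -> continuous phi r) ->
  (forall r, D r -> f r = f r0 + RInt phi r0 r)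
  <-> (forall r, D r -> is_derive f r (phi r)).
Proof.
  intros hopen hconv h0 hc; split.
  - intros hf r hr.
    apply is_derive_ext_loc with (fun r => f r0 + RInt phi r0 r).
    { apply (filter_imp D); [intros t ht; symmetry; auto | apply hopen, hr]. }
    replace (phi r) with (0 + phi r) by ring.
    apply (is_derive_plus (fun _ => f r0)); [auto_derive; auto|].
    apply is_derive_RInt with r0; [|auto].
    apply (filter_imp D); [|apply hopen, hr].
    intros t ht; apply (RInt_correct (V := R_CompleteNormedModule)).
    apply (ex_RInt_continuous (V := R_CompleteNormedModule)).
    intros z hz; apply hc, (order_convex_between D r0 z t); auto.
  - intros hf r hr.
    assert (hint : is_RInt phi r0 r (minus (f r) (f r0))).
    { apply (is_RInt_derive f phi); intros z hz; [apply hf | apply hc];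
        apply (order_convex_between D r0 z r); auto. }
    rewrite (is_RInt_unique _ _ _ _ hint).
    unfold minus, plus, opp; simpl; ring.
Qed.

(** * Radial functions in the plane *)

Lemma radius_sym (x y : R) : radius x y = radius y x.
Proof. unfold radius; f_equal; ring. Qed.

Lemma radius_sqr (x y : R) : radius x y ^ 2 = x ^ 2 + y ^ 2.
Proof. unfold radius; apply pow2_sqrt; nra. Qed.

Lemma is_derive_radius (x y : R) :
  0 < radius x y -> is_derive (fun s => radius s y) x (x / radius x y).
Proof.
  intros hpos.
  assert (h2 : 0 < x ^ 2 + y ^ 2).
  { rewrite <- radius_sqr; apply pow_lt, hpos. }
  unfold radius in *; auto_derive; [nra|].
  replace (x * (x * 1) + y * (y * 1)) with (x ^ 2 + y ^ 2) by ring.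
  field; lra.
Qed.

Lemma is_derive_radial (phi : R -> R) (l x y : R) :
  0 < radius x y -> is_derive phi (radius x y) l ->
  is_derive (fun s => phi (radius s y)) x (l * (x / radius x y)).
Proof.
  intros hpos hphi.
  rewrite Rmult_comm.
  apply (is_derive_comp phi (fun s => radius s y)); auto.
  apply is_derive_radius, hpos.
Qed.

Lemma locally_radius (D : R -> Prop) (x y : R) :
  open D -> 0 < radius x y -> D (radius x y) ->
  locally x (fun s => D (radius s y)).
Proof.
  intros hopen hpos hD.
  assert (hc : continuous (fun s => radius s y) x).
  { apply (ex_derive_continuous (fun s => radius s y)).
    eexists; apply is_derive_radius, hpos. }
  apply hc, hopen, hD.
Qed.

(** The shape of both components of the unit horizontal gradient along a line
    parallel to a coordinate axis: [k] is the sign of the rotated part. *)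
Lemma is_derive_mul_id_sub_mul (p1 p2 : R -> R) (x k c l m : R) :
  is_derive p1 x l -> is_derive p2 x m ->
  is_derive (fun s => k * (p1 s * s) - p2 s * c) x
    (k * (l * x + p1 x) - m * c).
Proof.
  intros d1 d2.
  auto_derive; [repeat split; auto; eexists; eassumption|].
  change (Derive (fun s => p1 s) x) with (Derive p1 x).
  change (Derive (fun s => p2 s) x) with (Derive p2 x).
  rewrite (Derive_of_is_derive _ _ _ d1), (Derive_of_is_derive _ _ _ d2); ring.
Qed.

(** * The distortion as a derivative along the profile *)

(** Up to sign, the horizontal gradient of [t - f r] has the angular component
    [2 r] and the radial component [f']; this is its length. *)
Definition hgrad_length (f : R -> R) (r : R) : R :=
  sqrt (Derive f r ^ 2 + 4 * r ^ 2).

(** The cosine of the angle whose tangent is [f' / (2 r)]. *)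
Definition tilt (f : R -> R) (r : R) : R := 2 * r / hgrad_length f r.

Lemma hgrad_length_pos (f : R -> R) (r : R) : 0 < r -> 0 < hgrad_length f r.
Proof. intros hr; apply sqrt_lt_R0; nra. Qed.

Lemma heisX_revolution (f : R -> R) (x y t : R) :
  0 < radius x y -> ex_derive f (radius x y) ->
  heisX (revolution_u f) x y t
  = 2 * y - x * (Derive f (radius x y) / radius x y).
Proof.
  intros hpos hf; unfold heisX, revolution_u.
  rewrite (Derive_of_is_derive (fun s => t - f (radius s y)) x
             (0 - Derive f (radius x y) * (x / radius x y))).
  - rewrite (Derive_of_is_derive (fun s => s - f (radius x y)) t 1).
    + field; lra.
    + auto_derive; auto; ring.
  - apply (is_derive_minus (fun _ => t)); [auto_derive; auto|].
    apply is_derive_radial; auto; apply Derive_correct, hf.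
Qed.

Lemma heisY_revolution (f : R -> R) (x y t : R) :
  0 < radius x y -> ex_derive f (radius x y) ->
  heisY (revolution_u f) x y t
  = - 2 * x - y * (Derive f (radius x y) / radius x y).
Proof.
  intros hpos hf; unfold heisY, revolution_u.
  rewrite (Derive_of_is_derive (fun s => t - f (radius x s)) y
             (0 - Derive f (radius x y) * (y / radius x y))).
  - rewrite (Derive_of_is_derive (fun s => s - f (radius x y)) t 1).
    + field; lra.
    + auto_derive; auto; ring.
  - apply (is_derive_ext (fun s => t - f (radius s x))).
    { intros s; rewrite radius_sym; reflexivity. }
    apply (is_derive_minus (fun _ => t)); [auto_derive; auto|].
    rewrite radius_sym in *.
    apply is_derive_radial; auto; apply Derive_correct, hf.
Qed.

(** The radial part [- f' / r (x, y)] and the rotated part [2 (y, - x)] of the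
    horizontal gradient are orthogonal. *)
Lemma hgrad_norm_revolution (f : R -> R) (x y t : R) :
  0 < radius x y -> ex_derive f (radius x y) ->
  hgrad_norm (revolution_u f) x y t = hgrad_length f (radius x y).
Proof.
  intros hpos hf; unfold hgrad_norm, hgrad_length.
  rewrite heisX_revolution, heisY_revolution by assumption.
  f_equal.
  pose proof (radius_sqr x y) as h2.
  transitivity (4 * (x ^ 2 + y ^ 2)
    + (x ^ 2 + y ^ 2) * (Derive f (radius x y) / radius x y) ^ 2); [ring|].
  rewrite <- h2; field; lra.
Qed.

Lemma ex_derive_hgrad_length (f : R -> R) (r : R) :
  0 < r -> ex_derive (Derive f) r -> ex_derive (hgrad_length f) r.
Proof.
  intros hr hf; unfold hgrad_length.
  auto_derive; split; auto; split; auto; nra.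
Qed.

(** The radial part of the unit horizontal gradient is curl-free, so only its
    rotated part [psi (y, - x)] contributes, and
    [- (2 psi + r psi') = - (r^2 psi)' / r]. *)
Lemma symplectic_distortion_revolution (D : R -> Prop) (f : R -> R)
    (x y t : R) :
  open D -> (forall r, D r -> 0 < r) ->
  (forall r, D r -> ex_derive f r /\ ex_derive (Derive f) r) ->
  D (radius x y) ->
  symplectic_distortion (revolution_u f) x y t
  = - Derive (fun r => r * tilt f r) (radius x y) / radius x y.
Proof.
  intros hopen hpos hf hD.
  set (phi := fun r => Derive f r / (r * hgrad_length f r)).
  set (psi := fun r => 2 / hgrad_length f r).
  set (rho := radius x y).
  assert (hrho : 0 < rho) by (apply hpos, hD).
  pose proof (hgrad_length_pos f rho hrho) as hlen.
  destruct (hf rho hD) as [_ hf2].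
  pose proof (ex_derive_hgrad_length f rho hrho hf2) as hexlen.
  assert (hphi : ex_derive phi rho).
  { unfold phi; auto_derive; repeat split; auto.
    apply Rgt_not_eq, Rmult_lt_0_compat; lra. }
  assert (hpsi : ex_derive psi rho).
  { unfold psi; auto_derive; repeat split; auto; lra. }
  assert (unit_X : forall x y t, D (radius x y) ->
    heisX (revolution_u f) x y t / hgrad_norm (revolution_u f) x y t
    = psi (radius x y) * y - phi (radius x y) * x).
  { intros x' y' t' h.
    pose proof (hpos _ h).
    pose proof (hgrad_length_pos f (radius x' y') (hpos _ h)).
    destruct (hf _ h).
    rewrite heisX_revolution, hgrad_norm_revolution by auto.
    unfold phi, psi; field; lra. }
  assert (unit_Y : forall x y t, D (radius x y) ->
    heisY (revolution_u f) x y t / hgrad_norm (revolution_u f) x y t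
    = - (psi (radius x y) * x) - phi (radius x y) * y).
  { intros x' y' t' h.
    pose proof (hpos _ h).
    pose proof (hgrad_length_pos f (radius x' y') (hpos _ h)).
    destruct (hf _ h).
    rewrite heisY_revolution, hgrad_norm_revolution by auto.
    unfold phi, psi; field; lra. }
  (* The unit gradient does not depend on [t], so the [T]-terms of the two
     outer fields vanish. *)
  unfold symplectic_distortion.
  unfold heisX at 1.
  rewrite (Derive_ext (fun s => heisY (revolution_u f) x y s
      / hgrad_norm (revolution_u f) x y s) (fun _ => - (psi rho * x) - phi rho * y) t)
    by (intros s; apply unit_Y, hD).
  rewrite Derive_const.
  unfold heisY at 2.
  rewrite (Derive_ext (fun s => heisX (revolution_u f) x y s
      / hgrad_norm (revolution_u f) x y s) (fun _ => psi rho * y - phi rho * x) t)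
    by (intros s; apply unit_X, hD).
  rewrite Derive_const.
  assert (radial : forall g a b, radius a b = rho -> ex_derive g rho ->
            is_derive (fun s => g (radius s b)) a (Derive g rho * (a / rho))).
  { intros g a b hab hg; rewrite <- hab.
    apply is_derive_radial; rewrite hab; auto; apply Derive_correct, hg. }
  assert (radius_yx : radius y x = rho) by apply radius_sym.
  rewrite (Derive_of_is_derive_loc _
      (fun s => - 1 * (psi (radius s y) * s) - phi (radius s y) * y) x
      (- 1 * (Derive psi rho * (x / rho) * x + psi rho)
       - Derive phi rho * (x / rho) * y)).
  2: { apply (filter_imp (fun s => D (radius s y))).
       - intros s hs; rewrite unit_Y by exact hs; ring.
       - apply locally_radius; auto. }
  2: apply (is_derive_mul_id_sub_mul (fun s => psi (radius s y))); auto.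
  rewrite (Derive_of_is_derive_loc _
      (fun s => 1 * (psi (radius s x) * s) - phi (radius s x) * x) y
      (1 * (Derive psi rho * (y / rho) * y + psi rho)
       - Derive phi rho * (y / rho) * x)).
  2: { apply (filter_imp (fun s => D (radius s x))).
       - intros s hs; rewrite radius_sym in *; rewrite unit_X by exact hs; ring.
       - apply locally_radius; rewrite ?radius_yx; auto. }
  2: { replace (psi rho) with (psi (radius y x)) by (rewrite radius_yx; auto).
       apply (is_derive_mul_id_sub_mul (fun s => psi (radius s x))); auto. }
  rewrite (Derive_ext (fun r => r * tilt f r) (fun r => r ^ 2 * psi r)).
  2: { intros r; unfold tilt, psi, Rdiv; ring. }
  rewrite (Derive_of_is_derive (fun r => r ^ 2 * psi r) rho
             (2 * rho * psi rho + rho ^ 2 * Derive psi rho)).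
  2: { auto_derive; auto.
       change (Derive (fun s => psi s) rho) with (Derive psi rho); ring. }
  pose proof (radius_sqr x y) as h2; fold rho in h2.
  transitivity (- 2 * psi rho - Derive psi rho * ((x ^ 2 + y ^ 2) / rho));
    [field; lra|].
  rewrite <- h2; field; lra.
Qed.

Lemma ex_derive_tilt (f : R -> R) (r : R) :
  0 < r -> ex_derive (Derive f) r -> ex_derive (tilt f) r.
Proof.
  intros hr hf.
  pose proof (ex_derive_hgrad_length f r hr hf); pose proof (hgrad_length_pos f r hr).
  unfold tilt; auto_derive; repeat split; auto; lra.
Qed.

Lemma is_derive_arccos_arg_times (q c1 r : R) :
  0 < r -> is_derive (fun s => s * arccos_arg q c1 s) r (- (q * r)).
Proof.
  intros hr; unfold arccos_arg; auto_derive; [repeat split; lra | field; lra].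
Qed.

(** Both [r tilt] and [r arccos_arg] have derivative [- q r], for any [c1], so
    they differ by a constant, which is absorbed into [c1]. *)
Lemma constant_distortion_iff_tilt (D : R -> Prop) (f : R -> R) (q r0 : R) :
  open D -> order_convex D -> D r0 -> (forall r, D r -> 0 < r) ->
  (forall r, D r -> ex_derive f r /\ ex_derive (Derive f) r) ->
  constant_distortion (revolution_surface D f) (revolution_u f) q
  <-> exists c1 : R, forall r, D r -> tilt f r = arccos_arg q c1 r.
Proof.
  intros hopen hconv h0 hpos hf; split.
  - intros hq.
    assert (dtilt : forall r, D r -> is_derive (fun s => s * tilt f s) r (- (q * r))).
    { intros r hr; pose proof (hpos r hr) as hr0.
      (* By rotation symmetry, testing on the half-line [y = 0] suffices. *)
      assert (hrad : radius r 0 = r).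
      { unfold radius; replace (r ^ 2 + 0 ^ 2) with (r ^ 2) by ring.
        apply sqrt_pow2; lra. }
      destruct (hf r hr) as [hf1 hf2].
      assert (hQ : symplectic_distortion (revolution_u f) r 0 (f r) = q).
      { apply hq.
        - split; [rewrite hrad; auto|].
          unfold revolution_u; rewrite hrad; ring.
        - rewrite hgrad_norm_revolution; rewrite hrad; auto.
          apply Rgt_not_eq, hgrad_length_pos, hr0. }
      rewrite (symplectic_distortion_revolution D) in hQ by (rewrite ?hrad; auto).
      rewrite hrad in hQ.
      replace (- (q * r)) with (Derive (fun s => s * tilt f s) r)
        by (rewrite <- hQ; field; lra).
      apply Derive_correct, (ex_derive_mult (fun s => s)).
      - apply ex_derive_id.
      - apply ex_derive_tilt; auto. }
    set (w := fun r => r * tilt f r - r * arccos_arg q 0 r).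
    assert (dw : forall r, D r -> is_derive w r 0).
    { intros r hr; replace 0 with (- (q * r) - - (q * r)) by ring.
      apply (is_derive_minus (fun s => s * tilt f s)); auto.
      apply is_derive_arccos_arg_times; auto. }
    exists (- w r0); intros r hr; pose proof (hpos r hr).
    rewrite (eq_of_derive_zero D w r0 r) by auto.
    unfold w, arccos_arg; field; lra.
  - intros [c1 hc1] x y t [hD _] _.
    pose proof (hpos _ hD).
    rewrite (symplectic_distortion_revolution D) by auto.
    rewrite (Derive_of_is_derive_loc _ (fun r => r * arccos_arg q c1 r) _
               (- (q * radius x y))); [field; lra | |].
    + apply (filter_imp D); [|apply hopen, hD].
      intros r hr; rewrite hc1; auto.
    + apply is_derive_arccos_arg_times; auto.
Qed.

(** * Solving for the slope of the profile *)

(** If the value [1] were taken at [s], the quadratic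
    [p r = r (arccos_arg q c1 r - 1)] would have an interior maximum [0] there.
    Then [q >= 0] by the second derivative, while [p' s = - q s - 1 = 0] forces
    [q < 0]. *)
Lemma arccos_arg_lt_1 (D : R -> Prop) (q c1 s : R) :
  open D -> (forall r, D r -> 0 < arccos_arg q c1 r <= 1 /\ 0 < r) -> D s ->
  arccos_arg q c1 s < 1.
Proof.
  intros hopen hA hs.
  destruct (hA s hs) as [[hA0 hA1] hs0].
  apply Rnot_le_lt; intros hge.
  assert (heq : - q * s ^ 2 / 2 - c1 - s = 0).
  { replace (- q * s ^ 2 / 2 - c1) with (s * arccos_arg q c1 s)
      by (unfold arccos_arg; field; lra).
    replace (arccos_arg q c1 s) with 1 by lra; ring. }
  assert (hle : forall r, D r -> - q * r ^ 2 / 2 - c1 - r <= 0).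
  { intros r hr; destruct (hA r hr) as [[_ h1] h2].
    replace (- q * r ^ 2 / 2 - c1) with (r * arccos_arg q c1 r)
      by (unfold arccos_arg; field; lra).
    nra. }
  destruct (hopen s hs) as [eta heta].
  assert (hnear : forall h, Rabs h < eta -> D (s + h)).
  { intros h hh; apply heta.
    change (Rabs (s + h - s) < eta).
    replace (s + h - s) with h by ring; exact hh. }
  (* As [p s = 0], the sum [p (s + h) + p (s - h)] equals [- q h^2], which gives
     [q >= 0]; then [p (s - h) = h (1 + q (s - h / 2))] is positive because
     [h <= s]. *)
  set (h := Rmin (eta / 2) s).
  pose proof (cond_pos eta) as heta0.
  assert (hh : 0 < h /\ h <= eta / 2 /\ h <= s).
  { unfold h; split; [apply Rmin_glb_lt; lra|].
    split; [apply Rmin_l | apply Rmin_r]. }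
  pose proof (hle (s + h) (hnear h ltac:(rewrite Rabs_right; lra))) as right.
  pose proof (hle (s + - h) (hnear (- h) ltac:(rewrite Rabs_Ropp, Rabs_right; lra)))
    as left.
  assert (hq : 0 <= q) by nra.
  nra.
Qed.

Lemma tan_sign (eps x : R) :
  eps = 1 \/ eps = - 1 -> tan (eps * x) = eps * tan x.
Proof.
  intros [-> | ->]; [rewrite !Rmult_1_l; reflexivity|].
  replace (- 1 * x) with (- x) by ring; rewrite tan_neg; ring.
Qed.

Lemma tan_acos_pos (A : R) : 0 < A < 1 -> 0 < tan (acos A).
Proof.
  intros hA; rewrite tan_acos by lra.
  apply Rdiv_lt_0_compat; [|lra].
  apply sqrt_lt_R0; unfold Rsqr; nra.
Qed.

Lemma tan_acos_sqr (A : R) : 0 < A <= 1 -> tan (acos A) ^ 2 = / A ^ 2 - 1.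
Proof.
  intros hA; rewrite tan_acos by lra.
  unfold Rdiv; rewrite Rpow_mult_distr, pow2_sqrt; unfold Rsqr; [field; lra | nra].
Qed.

Lemma tilt_bounds (f : R -> R) (r : R) : 0 < r -> 0 < tilt f r <= 1.
Proof.
  intros hr; pose proof (hgrad_length_pos f r hr) as hs; unfold tilt.
  split; [apply Rdiv_lt_0_compat; lra|].
  apply Rle_div_l; [exact hs|]; rewrite Rmult_1_l.
  unfold hgrad_length; rewrite <- (sqrt_pow2 (2 * r)) by lra.
  apply sqrt_le_1_alt; nra.
Qed.

Lemma tilt_eq_iff (f : R -> R) (r A : R) :
  0 < r -> 0 < A <= 1 ->
  tilt f r = A <-> Derive f r ^ 2 = (2 * r * tan (acos A)) ^ 2.
Proof.
  intros hr hA; pose proof (hgrad_length_pos f r hr) as hs.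
  rewrite Rpow_mult_distr, tan_acos_sqr by lra.
  assert (hs2 : hgrad_length f r ^ 2 = Derive f r ^ 2 + 4 * r ^ 2).
  { unfold hgrad_length; apply pow2_sqrt; nra. }
  replace (Derive f r ^ 2) with (hgrad_length f r ^ 2 - 4 * r ^ 2) by lra.
  unfold tilt; split.
  - intros <-; field; lra.
  - intros heq.
    assert (hs' : hgrad_length f r = 2 * r / A).
    { rewrite <- (sqrt_pow2 (hgrad_length f r)) by lra.
      rewrite <- (sqrt_pow2 (2 * r / A)).
      - f_equal; transitivity ((2 * r) ^ 2 * (/ A ^ 2 - 1) + 4 * r ^ 2);
          [lra | field; lra].
      - apply Rlt_le, Rdiv_lt_0_compat; lra. }
    rewrite hs'; field; lra.
Qed.

(** From left to right, [arccos_arg < 1] makes the tangent positive, so that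
    [signed_square_root] applies and yields a single sign for the interval. *)
Lemma tilt_iff_slope (D : R -> Prop) (f : R -> R) (q c1 r0 : R) :
  open D -> order_convex D -> D r0 -> (forall r, D r -> 0 < r) ->
  (forall r, D r -> ex_derive f r /\ ex_derive (Derive f) r) ->
  (forall r, D r -> tilt f r = arccos_arg q c1 r)
  <-> (forall r, D r -> 0 < arccos_arg q c1 r <= 1)
      /\ exists eps : R, (eps = 1 \/ eps = - 1) /\
         forall r, D r ->
           is_derive f r (2 * r * tan (eps * acos (arccos_arg q c1 r))).
Proof.
  intros hopen hconv h0 hpos hf; split.
  - intros htilt.
    assert (hA : forall r, D r -> 0 < arccos_arg q c1 r <= 1).
    { intros r hr; rewrite <- htilt by exact hr; apply tilt_bounds; auto. }
    split; [exact hA|].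
    destruct (signed_square_root D (Derive f)
        (fun r => 2 * r * tan (acos (arccos_arg q c1 r))) r0)
      as [eps [heps hslope]]; auto.
    + intros r hr; apply (ex_derive_continuous (Derive f)), hf, hr.
    + intros r hr; pose proof (hpos r hr); split.
      * apply Rmult_lt_0_compat; [lra|].
        apply tan_acos_pos; split; [apply hA, hr|].
        apply (arccos_arg_lt_1 D); auto.
      * apply tilt_eq_iff; auto.
    + exists eps; split; auto; intros r hr.
      rewrite tan_sign by exact heps.
      replace (2 * r * (eps * tan (acos (arccos_arg q c1 r)))) with (Derive f r)
        by (rewrite hslope by exact hr; ring).
      apply Derive_correct, hf, hr.
  - intros [hA [eps [heps hslope]]] r hr.
    apply tilt_eq_iff; auto.
    rewrite (Derive_of_is_derive _ _ _ (hslope r hr)), tan_sign by exact heps.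
    destruct heps as [-> | ->]; ring.
Qed.

(** * The two families *)

(** [acos] has a vertical tangent at [1], which the strict bound of
    [arccos_arg_lt_1] avoids. *)
Lemma continuous_slope (D : R -> Prop) (q c1 eps r : R) :
  open D -> (forall s, D s -> 0 < s) -> (eps = 1 \/ eps = - 1) ->
  (forall s, D s -> 0 < arccos_arg q c1 s <= 1) -> D r ->
  continuous (fun s => 2 * s * tan (eps * acos (arccos_arg q c1 s))) r.
Proof.
  intros hopen hpos heps hA hr.
  apply (continuous_ext_loc _ (fun s => 2 * s
    * (eps * (sqrt (1 - (arccos_arg q c1 s) ^ 2) / arccos_arg q c1 s)))).
  - apply (filter_imp D); [|apply hopen, hr].
    intros s hs; rewrite tan_sign by exact heps.
    rewrite tan_acos by (pose proof (hA s hs); lra).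
    rewrite Rsqr_pow2; reflexivity.
  - pose proof (hpos r hr); pose proof (hA r hr) as hAr.
    assert (hlt : arccos_arg q c1 r < 1) by (apply (arccos_arg_lt_1 D); auto).
    apply (ex_derive_continuous (fun s => 2 * s
      * (eps * (sqrt (1 - (arccos_arg q c1 s) ^ 2) / arccos_arg q c1 s)))).
    assert (hex : ex_derive (arccos_arg q c1) r).
    { unfold arccos_arg; auto_derive; lra. }
    auto_derive; repeat split; auto; [nra | lra].
Qed.

(** [(C r^2 - 4)^(3/2) / (3 C)], written without real exponents. *)
Definition profile_zero (C r : R) : R :=
  (C * r ^ 2 - 4) * sqrt (C * r ^ 2 - 4) / (3 * C).

Lemma profile_zero_sqr (C r : R) :
  0 < C -> 0 <= C * r ^ 2 - 4 ->
  profile_zero C r ^ 2 = 1 / (9 * C ^ 2) * (C * r ^ 2 - 4) ^ 3.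
Proof.
  intros hC hr; unfold profile_zero.
  transitivity ((C * r ^ 2 - 4) ^ 2 * sqrt (C * r ^ 2 - 4) ^ 2 / (9 * C ^ 2));
    [field; lra|].
  rewrite pow2_sqrt by lra; field; lra.
Qed.

Lemma is_derive_profile_zero (C r : R) :
  0 < C -> 0 < C * r ^ 2 - 4 ->
  is_derive (profile_zero C) r (r * sqrt (C * r ^ 2 - 4)).
Proof.
  intros hC hr; unfold profile_zero.
  assert (hs : 0 < sqrt (C * r ^ 2 - 4)) by (apply sqrt_lt_R0, hr).
  auto_derive; [simpl in hr; lra|].
  replace (C * (r * (r * 1)) + - (4)) with (C * r ^ 2 - 4) by ring.
  pose proof (pow2_sqrt (C * r ^ 2 - 4) (Rlt_le _ _ hr)) as h2.
  set (w := sqrt (C * r ^ 2 - 4)) in *.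
  rewrite <- h2.
  field; lra.
Qed.

Lemma slope_zero (c1 r : R) :
  c1 < 0 -> 0 < r -> arccos_arg 0 c1 r <= 1 ->
  2 * r * tan (acos (arccos_arg 0 c1 r)) = r * sqrt (4 / c1 ^ 2 * r ^ 2 - 4).
Proof.
  intros hc hr hA1.
  assert (heq : arccos_arg 0 c1 r = - c1 / r) by (unfold arccos_arg; field; lra).
  assert (hA0 : 0 < arccos_arg 0 c1 r) by (rewrite heq; apply Rdiv_lt_0_compat; lra).
  set (A := arccos_arg 0 c1 r) in *.
  replace (4 / c1 ^ 2 * r ^ 2 - 4) with (2 ^ 2 * (/ A ^ 2 - 1))
    by (rewrite heq; field; lra).
  rewrite <- tan_acos_sqr, <- Rpow_mult_distr by lra.
  rewrite sqrt_pow2; [ring|].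
  rewrite tan_acos by lra.
  apply Rmult_le_pos; [lra|]; apply Rmult_le_pos; [apply sqrt_pos|].
  apply Rlt_le, Rinv_0_lt_compat, hA0.
Qed.

(** The parameters correspond by [C = 4 / c1^2] with [c1 < 0]. From left to
    right the sign is that of [f - C'], which cannot vanish since [C r^2 > 4] on the interval. *)
Lemma family_zero_iff (D : R -> Prop) (f : R -> R) (r0 : R) :
  open D -> order_convex D -> D r0 -> (forall r, D r -> 0 < r) ->
  (forall r, D r -> ex_derive f r) ->
  (exists C C' : R, family_zero D f C C')
  <-> exists c1 : R,
      (forall r, D r -> 0 < arccos_arg 0 c1 r <= 1)
      /\ exists eps : R, (eps = 1 \/ eps = - 1) /\
         forall r, D r ->
           is_derive f r (2 * r * tan (eps * acos (arccos_arg 0 c1 r))).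
Proof.
  intros hopen hconv h0 hpos hf; split.
  - intros [C [C' hfam]].
    assert (hC : 0 < C).
    { destruct (hfam r0 h0) as [h _]; pose proof (pow2_ge_0 r0); nra. }
    assert (hsC : 0 < sqrt C) by (apply sqrt_lt_R0, hC).
    pose proof (pow2_sqrt C (Rlt_le _ _ hC)) as hsC2.
    (* The negative root of [C = 4 / c1^2]: the argument [- c1 / r] of the
       arccosine has to be positive. *)
    set (c1 := - (2 / sqrt C)).
    assert (hc1 : c1 < 0).
    { unfold c1; pose proof (Rdiv_lt_0_compat 2 (sqrt C)); lra. }
    assert (hCc : 4 / c1 ^ 2 = C) by (rewrite <- hsC2; unfold c1; field; lra).
    assert (hA : forall r, D r -> 0 < arccos_arg 0 c1 r <= 1).
    { intros r hr; pose proof (hpos r hr) as hr0; destruct (hfam r hr) as [h _].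
      replace (arccos_arg 0 c1 r) with (2 / (sqrt C * r))
        by (unfold arccos_arg, c1; field; lra).
      assert (hsr : 0 < sqrt C * r) by (apply Rmult_lt_0_compat; lra).
      split; [apply Rdiv_lt_0_compat; lra|].
      apply Rle_div_l; [lra|].
      assert (hsr2 : (sqrt C * r) ^ 2 = C * r ^ 2)
        by (rewrite <- hsC2 at 2; ring).
      nra. }
    exists c1; split; [exact hA|].
    destruct (signed_square_root D (fun r => f r - C') (profile_zero C) r0)
      as [eps [heps hprof]]; auto.
    + intros r hr; apply (ex_derive_continuous (fun r => f r - C')).
      auto_derive; auto.
    + intros r hr; destruct (hfam r hr) as [h1 h2]; split.
      * unfold profile_zero; apply Rdiv_lt_0_compat; [|lra].
        apply Rmult_lt_0_compat; [lra | apply sqrt_lt_R0; lra].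
      * rewrite h2, profile_zero_sqr; lra.
    + exists eps; split; auto; intros r hr.
      destruct (hfam r hr) as [h1 _].
      rewrite tan_sign by exact heps.
      replace (2 * r * (eps * tan (acos (arccos_arg 0 c1 r))))
        with (0 + eps * (r * sqrt (C * r ^ 2 - 4))).
      2: { rewrite <- hCc, <- slope_zero; auto; [ring | apply hA, hr]. }
      apply (is_derive_ext_loc (fun r => C' + eps * profile_zero C r)).
      { apply (filter_imp D); [|apply hopen, hr].
        intros s hs; pose proof (hprof s hs); simpl in *; lra. }
      apply (is_derive_plus (fun _ => C')); [auto_derive; auto|].
      apply is_derive_scal, is_derive_profile_zero; auto.
  - intros [c1 [hA [eps [heps hslope]]]].
    assert (hc1 : c1 < 0).
    { pose proof (hpos r0 h0); destruct (hA r0 h0) as [h _].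
      replace c1 with (- (r0 * arccos_arg 0 c1 r0))
        by (unfold arccos_arg; field; lra).
      pose proof (Rmult_lt_0_compat r0 (arccos_arg 0 c1 r0)); lra. }
    set (C := 4 / c1 ^ 2).
    assert (hC : 0 < C) by (apply Rdiv_lt_0_compat; [lra | nra]).
    assert (hCr : forall r, D r -> 0 < C * r ^ 2 - 4).
    { intros r hr; pose proof (hpos r hr).
      assert (hlt : arccos_arg 0 c1 r < 1) by (apply (arccos_arg_lt_1 D); auto).
      replace (arccos_arg 0 c1 r) with (- c1 / r) in hlt
        by (unfold arccos_arg; field; lra).
      apply Rlt_div_l in hlt; [|lra].
      replace (C * r ^ 2 - 4) with (C * (r ^ 2 - c1 ^ 2))
        by (unfold C; field; lra).
      apply Rmult_lt_0_compat; nra. }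
    (* The function [w] is constant, and [C'] is its value. *)
    set (w := fun r => f r - eps * profile_zero C r).
    assert (dw : forall r, D r -> is_derive w r 0).
    { intros r hr.
      replace 0 with (2 * r * tan (eps * acos (arccos_arg 0 c1 r))
                      - eps * (r * sqrt (C * r ^ 2 - 4))).
      2: { rewrite tan_sign by exact heps.
           unfold C; rewrite <- slope_zero; auto; [ring | apply hA, hr]. }
      apply (is_derive_minus f); auto.
      apply is_derive_scal, is_derive_profile_zero; auto. }
    exists C, (w r0); intros r hr; split; auto.
    rewrite (eq_of_derive_zero D w r0 r) by auto.
    rewrite <- profile_zero_sqr by (pose proof (hCr r hr); lra).
    unfold w; destruct heps as [-> | ->]; ring.
Qed.

(** * The classification *)

Lemma open_radii_between (a : R) (b : Rbar) : open (radii_between a b).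
Proof. apply open_and; [apply open_gt | apply open_Rbar_lt]. Qed.

Lemma order_convex_radii_between (a : R) (b : Rbar) :
  order_convex (radii_between a b).
Proof.
  intros x y z [hx _] [_ hz] hy; split; [lra|].
  apply (Rbar_le_lt_trans y z b); [apply hy | exact hz].
Qed.

Lemma radii_between_nonempty (a : R) (b : Rbar) :
  Rbar_lt a b -> exists r, radii_between a b r.
Proof.
  destruct b as [b | |]; simpl; intros hab.
  - exists ((a + b) / 2); split; simpl; lra.
  - exists (a + 1); split; simpl; [lra | exact I].
  - contradiction.
Qed.

Theorem theorem4p12 (a : R) (b : Rbar) (f : R -> R) (q : R)
    (ha : 0 <= a) (hab : Rbar_lt a b)
    (hf : C2_on (radii_between a b) f) :
  (q = 0 ->
     (constant_distortion (revolution_surface (radii_between a b) f)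
        (revolution_u f) q
      <-> exists C C' : R, family_zero (radii_between a b) f C C'))
  /\
  (q <> 0 ->
     forall r0 : R, radii_between a b r0 ->
     (constant_distortion (revolution_surface (radii_between a b) f)
        (revolution_u f) q
      <-> exists c1 eps : R,
            family_nonzero (radii_between a b) f q r0 c1 eps)).
Proof.
  pose proof (open_radii_between a b) as hopen.
  pose proof (order_convex_radii_between a b) as hconv.
  assert (hpos : forall r, radii_between a b r -> 0 < r)
    by (intros r [hr _]; lra).
  assert (hd : forall r, radii_between a b r ->
            ex_derive f r /\ ex_derive (Derive f) r).
  { intros r hr; destruct (hf r hr) as [hk _].
    exact (conj (hk 1%nat ltac:(lia)) (hk 2%nat ltac:(lia))). }
  assert (slope : forall r0, radii_between a b r0 ->
    constant_distortion (revolution_surface (radii_between a b) f)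
      (revolution_u f) q
    <-> exists c1 : R,
        (forall r, radii_between a b r -> 0 < arccos_arg q c1 r <= 1)
        /\ exists eps : R, (eps = 1 \/ eps = - 1) /\
           forall r, radii_between a b r ->
             is_derive f r (2 * r * tan (eps * acos (arccos_arg q c1 r)))).
  { intros r0 h0.
    rewrite (constant_distortion_iff_tilt _ f q r0) by auto.
    split; intros [c1 h]; exists c1;
      apply (tilt_iff_slope _ f q c1 r0); auto. }
  split.
  - intros ->; destruct (radii_between_nonempty a b hab) as [r0 h0].
    rewrite (slope r0 h0); symmetry.
    apply (family_zero_iff _ f r0); auto; intros r hr; apply hd, hr.
  - intros _ r0 h0; rewrite (slope r0 h0); split.
    + intros [c1 [hA [eps [heps hder]]]]; exists c1, eps.
      repeat split; auto; try (apply hA; auto).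
      apply RInt_iff_is_derive; auto.
      intros r hr; apply (continuous_slope (radii_between a b)); auto.
    + intros [c1 [eps [heps [hA hint]]]]; exists c1; split; auto.
      exists eps; split; auto.
      apply (RInt_iff_is_derive _ f _ r0); auto.
      intros r hr; apply (continuous_slope (radii_between a b)); auto.
Qed.
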